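(* Let $\mathfrak g_0=\mathfrak k\oplus\mathfrak p_0$ be the complexified Lie algebra of the Cartan motion group $G(\mathbb R)_0$. The Casimir element $\Omega(\mathfrak p_0,\beta_0)\in\mathcal U(\mathfrak g_0)$ lies in $\mathcal Z(\mathfrak g_0)^K$, the space of $K$-invariants in the center $\mathcal Z(\mathfrak g_0)$ of $\mathcal U(\mathfrak g_0)$.
   Context: Setting. $G$ is a connected complex reductive algebraic group with an antiholomorphic involution $\sigma$ such that $G(\mathbb R):=G^\sigma$ is connected and noncompact; $\theta$ is a corresponding Cartan involution of $G$ (commuting with $\sigma$); $K:=G^\theta$ and $K(\mathbb R):=K^\sigma$ is a maximal compact subgroup of $G(\mathbb R)$. Put $\mathfrak g=\mathrm{Lie}(G)$, $\mathfrak k=\mathrm{Lie}(K)$, and let $\mathfrak p$ be the $(-1)$-eigenspace of $\theta$ on $\mathfrak g$; then $\mathfrak g=\mathfrak k\oplus\mathfrak p$, with real forms $\mathfrak g^\sigma=\mathfrak k^\sigma\oplus\mathfrak p^\sigma$. The Cartan motion group is $G(\mathbb R)_0=\mathfrak p^\sigma\rtimes K(\mathbb R)$. Its complexified Lie algebra is $\mathfrak g_0=\mathfrak k\oplus\mathfrak p_0$ with $\mathfrak p_0=\mathfrak p$ as a $K$-module and bracket $[X_1+Y_1,X_2+Y_2]_0=[Y_1,X_2]+[X_1,Y_2]+[Y_1,Y_2]$ for $X_i\in\mathfrak p$, $Y_i\in\mathfrak k$ (so $\mathfrak p_0$ is an abelian ideal). $K$ acts on $\mathfrak g_0$, and hence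 on $\mathcal U(\mathfrak g_0)$, through the adjoint action. Form. Fix a symmetric bilinear form $\beta$ on $\mathfrak g$ which restricts to the Killing form on $[\mathfrak g,\mathfrak g]$, is positive definite on $\mathfrak p^\sigma$ and negative definite on $\mathfrak k^\sigma$, and is $\theta$-, $K$- and $\mathfrak g$-invariant. Put $\beta_0=\beta|_{\mathfrak p_0\times\mathfrak p_0}$, which is nondegenerate. Casimir. $\omega(\mathfrak p_0,\beta_0)\in\mathfrak p_0\otimes_{\mathbb C}\mathfrak p_0$ is the image of $\operatorname{Id}_{\mathfrak p_0}$ under $\operatorname{End}(\mathfrak p_0)\cong\mathfrak p_0^*\otimes\mathfrak p_0\cong\mathfrak p_0\otimes\mathfrak p_0$, the last map using $\beta_0$; $\Omega(\mathfrak p_0,\beta_0)$ is its image in $\mathcal U(\mathfrak g_0)$. For a basis $\{e_i\}$ of $\mathfrak p_0$ with $\beta_0$-dual basis $\{e'_i\}$, $\Omega(\mathfrak p_0,\beta_0)=\sum_i e'_ie_i$. *)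

(* Defs.v *)
From HB Require Import structures.
From mathcomp Require Import all_boot all_order all_algebra.
From mathcomp Require Import generic_quotient.
From mathcomp Require Import boolp classical_sets reals topology normedtype derive.
From mathcomp Require Import complex.
From mathcomp Require mpoly.

Set Implicit Arguments.
Unset Strict Implicit.
Unset Printing Implicit Defensive.
Import Order.TTheory GRing.Theory Num.Theory.
Import numFieldNormedType.Exports.
Local Open Scope classical_set_scope.
Local Open Scope ring_scope.
Local Open Scope quotient_scope.

(* The universal enveloping algebra U(L) = T(L) / (xy - yx - [x, y]), given  *)
(* by generators and relations: formal noncommutative polynomial expressions *)
(* in the elements of L, modulo the least congruence [ueq] that contains the *)
(* F-algebra axioms, the linearity of the generators, and the relations      *)
(* xy - yx = [x, y].                                                         *)

Inductive uterm (F L : Type) : Type :=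
| UVar of L
| UCst of F
| UAdd of uterm F L & uterm F L
| UMul of uterm F L & uterm F L.
Arguments UVar {F L}.
Arguments UCst {F L}.

HB.instance Definition _ (F L : Type) := gen_eqMixin (uterm F L).
HB.instance Definition _ (F L : Type) := gen_choiceMixin (uterm F L).

Section UniversalEnvelopingAlgebra.
Variables (F : comNzRingType) (L : lmodType F) (bracket : L -> L -> L).
Implicit Types (r s t : uterm F L) (a b : F) (x y : L).

Inductive ueq : uterm F L -> uterm F L -> Prop :=
| ueq_refl t : ueq t t
| ueq_sym s t : ueq s t -> ueq t s
| ueq_trans s t r : ueq s t -> ueq t r -> ueq s r
| ueq_congD s s' t t' : ueq s s' -> ueq t t' -> ueq (UAdd s t) (UAdd s' t')
| ueq_congM s s' t t' : ueq s s' -> ueq t t' -> ueq (UMul s t) (UMul s' t')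
| ueq_addA s t r : ueq (UAdd s (UAdd t r)) (UAdd (UAdd s t) r)
| ueq_addC s t : ueq (UAdd s t) (UAdd t s)
| ueq_add0 t : ueq (UAdd (UCst 0) t) t
| ueq_addN t : ueq (UAdd (UMul (UCst (-1)) t) t) (UCst 0)
| ueq_mulA s t r : ueq (UMul s (UMul t r)) (UMul (UMul s t) r)
| ueq_mul1 t : ueq (UMul (UCst 1) t) t
| ueq_mulDl s t r : ueq (UMul (UAdd s t) r) (UAdd (UMul s r) (UMul t r))
| ueq_mulDr s t r : ueq (UMul s (UAdd t r)) (UAdd (UMul s t) (UMul s r))
| ueq_cstD a b : ueq (UCst (a + b)) (UAdd (UCst a) (UCst b))
| ueq_cstM a b : ueq (UCst (a * b)) (UMul (UCst a) (UCst b))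
| ueq_cstC a t : ueq (UMul (UCst a) t) (UMul t (UCst a))
| ueq_varD x y : ueq (UVar (x + y)) (UAdd (UVar x) (UVar y))
| ueq_varZ a x : ueq (UVar (a *: x)) (UMul (UCst a) (UVar x))
| ueq_bracket x y :
    ueq (UMul (UVar x) (UVar y)) (UAdd (UMul (UVar y) (UVar x)) (UVar (bracket x y))).

Definition ueqb : rel (uterm F L) := fun s t => `[< ueq s t >].

Lemma ueqb_equiv : equiv_class_of ueqb.
Proof.
split=> [t|s t|t s r].
- by apply/asboolP; exact: ueq_refl.
- by apply/asboolP/asboolP => /ueq_sym.
- by move=> /asboolP st /asboolP tr; apply/asboolP; exact: ueq_trans st tr.
Qed.

Canonical ueq_equiv := EquivRelPack ueqb_equiv.

Definition uenv : Type := {eq_quot ueq_equiv}.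
HB.instance Definition _ := Choice.on uenv.

Definition upi (t : uterm F L) : uenv := \pi_{eq_quot ueq_equiv} t.
Definition urepr (u : uenv) : uterm F L := repr (u : {eq_quot ueq_equiv}).

Lemma ureprK u : upi (urepr u) = u.
Proof. exact: reprK. Qed.

Lemma upiP s t : upi s = upi t <-> ueq s t.
Proof.
by split=> [/eqmodP/asboolP|st]; last by apply/eqmodP/asboolP.
Qed.

Lemma urepr_pi t : ueq (urepr (upi t)) t.
Proof. by apply/upiP; rewrite ureprK. Qed.

Definition uadd (u v : uenv) := upi (UAdd (urepr u) (urepr v)).
Definition umul (u v : uenv) := upi (UMul (urepr u) (urepr v)).
Definition ucst (a : F) : uenv := upi (UCst a).

Lemma upiD s t : uadd (upi s) (upi t) = upi (UAdd s t).
Proof. by apply/upiP/ueq_congD; exact: urepr_pi. Qed.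

Lemma upiM s t : umul (upi s) (upi t) = upi (UMul s t).
Proof. by apply/upiP/ueq_congM; exact: urepr_pi. Qed.

Lemma uind (P : uenv -> Prop) : (forall t, P (upi t)) -> forall u, P u.
Proof. by move=> Ppi u; rewrite -(ureprK u). Qed.

Lemma uaddA : associative uadd.
Proof.
elim/uind=> s; elim/uind=> t; elim/uind=> r.
by rewrite !upiD; apply/upiP; constructor.
Qed.

Lemma uaddC : commutative uadd.
Proof. by elim/uind=> s; elim/uind=> t; rewrite !upiD; apply/upiP; constructor. Qed.

Lemma uadd0 : left_id (ucst 0) uadd.
Proof. by elim/uind=> t; rewrite !upiD; apply/upiP; constructor. Qed.

Lemma uaddN : left_inverse (ucst 0) (umul (ucst (-1))) uadd.
Proof. by elim/uind=> t; rewrite /ucst !(upiM, upiD); apply/upiP; constructor. Qed.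

HB.instance Definition _ := GRing.isZmodule.Build uenv uaddA uaddC uadd0 uaddN.

Lemma umulA : associative umul.
Proof.
elim/uind=> s; elim/uind=> t; elim/uind=> r.
by rewrite !upiM; apply/upiP; constructor.
Qed.

Lemma umul1 : left_id (ucst 1) umul.
Proof. by elim/uind=> t; rewrite !upiM; apply/upiP; constructor. Qed.

Lemma ucst_comm a u : umul (ucst a) u = umul u (ucst a).
Proof. by elim/uind: u => t; rewrite !upiM; apply/upiP; constructor. Qed.

Lemma umulr1 : right_id (ucst 1) umul.
Proof. by move=> u; rewrite -ucst_comm umul1. Qed.

Lemma umulDl : left_distributive umul +%R.
Proof.
elim/uind=> s; elim/uind=> t; elim/uind=> r.
by rewrite /+%R /= !(upiD, upiM); apply/upiP; constructor.
Qed.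

Lemma umulDr : right_distributive umul +%R.
Proof.
elim/uind=> s; elim/uind=> t; elim/uind=> r.
by rewrite /+%R /= !(upiD, upiM); apply/upiP; constructor.
Qed.

(* 1 != 0 in U(L), seen through the augmentation U(L) -> F. *)
Fixpoint uaug (t : uterm F L) : F :=
  match t with
  | UVar _ => 0
  | UCst a => a
  | UAdd s r => uaug s + uaug r
  | UMul s r => uaug s * uaug r
  end.

Lemma uaugP s t : ueq s t -> uaug s = uaug t.
Proof.
elim=> //=; intros; rewrite ?(mulr0, addr0, mulN1r, addNr, mul1r, add0r) //.
all: rewrite ?(addrA, mulrA, mulrDl, mulrDr) //; try congruence.
- exact: addrC.
- exact: mulrC.
Qed.

Lemma ucst10 : ucst 1 != 0 :> uenv.
Proof. by apply/eqP => /upiP/uaugP/eqP; rewrite /= oner_eq0. Qed.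

HB.instance Definition _ := GRing.Zmodule_isNzRing.Build uenv
  umulA umul1 umulr1 umulDl umulDr ucst10.

Definition uscale a (u : uenv) : uenv := ucst a * u.

Lemma ucstM a b : ucst a * ucst b = ucst (a * b).
Proof. by rewrite [LHS]upiM; apply/upiP/ueq_sym; constructor. Qed.

Lemma ucstD a b : ucst a + ucst b = ucst (a + b).
Proof. by rewrite [LHS]upiD; apply/upiP/ueq_sym; constructor. Qed.

Lemma uscaleA a b u : uscale a (uscale b u) = uscale (a * b) u.
Proof. by rewrite /uscale mulrA ucstM. Qed.

Lemma uscale1 : left_id 1 uscale.
Proof. by move=> u; exact: mul1r. Qed.

Lemma uscaleDr : right_distributive uscale +%R.
Proof. by move=> a u v; exact: mulrDr. Qed.

Lemma uscaleDl u : {morph uscale^~ u : a b / a + b}.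
Proof. by move=> a b; rewrite /uscale -ucstD mulrDl. Qed.

HB.instance Definition _ := GRing.Zmodule_isLmodule.Build F uenv
  uscaleA uscale1 uscaleDr uscaleDl.

Lemma uscaleAl a (u v : uenv) : a *: (u * v) = (a *: u) * v.
Proof. exact: mulrA. Qed.

HB.instance Definition _ := GRing.Lmodule_isLalgebra.Build F uenv uscaleAl.

Lemma uscaleAr a (u v : uenv) : a *: (u * v) = u * (a *: v).
Proof. by rewrite /GRing.scale /= /uscale !mulrA; congr (_ * _); exact: ucst_comm. Qed.

HB.instance Definition _ := GRing.Lalgebra_isAlgebra.Build F uenv uscaleAr.

Definition uinj (x : L) : uenv := upi (UVar x).

Definition ucentral (u : uenv) : Prop := forall v : uenv, u * v = v * u.

(* [u] is fixed by the algebra endomorphism of U(L) that extends [f]; as U(L)*)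
(* is generated by L there is at most one, and there is one as soon as [f]   *)
(* is a Lie algebra endomorphism of L.                                       *)
Definition ufixed_by (f : L -> L) (u : uenv) : Prop :=
  exists2 phi : {lrmorphism uenv -> uenv},
    (forall x, phi (uinj x) = uinj (f x)) & phi u = u.

End UniversalEnvelopingAlgebra.

(* An algebraic group is taken as a Zariski closed subgroup of some GL_N(C), *)
(* N > 0; reductive groups are linear.                                       *)

Definition Cx (R : realType) : numClosedFieldType := R[i].

Section Setting.
Variables (R : realType) (n : nat).
Local Notation C := (Cx R).
Local Notation M := 'M[C]_n.+1.
Implicit Types (A B G H N : set M) (f sigma theta : M -> M) (g h X Y Z : M).

Definition zariski_closed A : Prop :=
  exists S : set (mpoly.mpoly (n.+1 * n.+1) C), forall g,
    A g <-> g \is a GRing.unit /\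
            (forall q, S q -> mpoly.meval (fun i => mxvec g 0 i) q = 0).

Definition zariski_connected A : Prop :=
  forall B1 B2, zariski_closed B1 -> zariski_closed B2 ->
    A `<=` B1 `|` B2 -> A `&` B1 `&` B2 = set0 -> A `<=` B1 \/ A `<=` B2.

Definition algebraic_group G : Prop :=
  [/\ zariski_closed G, G 1, (forall g h, G g -> G h -> G (g * h))
    & (forall g, G g -> G g^-1)].

Definition unipotent g : Prop := exists m : nat, (g - 1) ^+ m = 0.

(* The unipotent radical, the largest closed connected normal unipotent      *)
(* subgroup, is trivial.                                                     *)
Definition reductive G : Prop :=
  forall N, algebraic_group N -> zariski_connected N -> N `<=` G ->
    (forall g h, G g -> N h -> N (g * h * g^-1)) ->
    (forall h, N h -> unipotent h) -> N `<=` [set 1].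

Definition conjm X : M := map_mx Num.conj X.

(* G is a closed complex submanifold of the invertible matrices, so that a   *)
(* map on it is holomorphic iff it extends, locally around each point, to    *)
(* holomorphic maps on open sets of matrices.                                *)
Definition hol_extension G f g (E : M -> M) : Prop :=
  (\forall x \near g, differentiable E x) /\ (\forall x \near g, G x -> f x = E x).

Definition holomorphic_on G f : Prop := forall g, G g -> exists E, hol_extension G f g E.

Definition antiholomorphic_on G f : Prop := holomorphic_on G (conjm \o f).

Definition group_involution G f : Prop :=
  [/\ (forall g, G g -> G (f g)),
      (forall g h, G g -> G h -> f (g * h) = f g * f h)
    & (forall g, G g -> f (f g) = g)].

Definition fixed_points G f : set M := [set g | G g /\ f g = g].

Definition antiholomorphic_involution G sigma : Prop :=
  group_involution G sigma /\ antiholomorphic_on G sigma.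

(* theta sigma is the involution of a compact real form of G; it follows     *)
(* that G^theta :&: G^sigma is maximal compact in G^sigma.                   *)
Definition cartan_involution G sigma theta : Prop :=
  [/\ group_involution G theta, holomorphic_on G theta,
      (forall g, G g -> sigma (theta g) = theta (sigma g))
    & compact (fixed_points G (theta \o sigma))].

Definition lie X Y : M := X * Y - Y * X.
Definition Ad g X : M := g * X * g^-1.

(* The subspace with a given set of elements (and 0 if there is none). *)
Definition vspace_of (P : set M) : {vspace M} :=
  xget 0%VS [set U : {vspace M} | forall X, X \in U <-> P X].

(* Lie(H) = T_1 H: the velocities at 0 of the holomorphic curves in H that   *)
(* pass through 1 at 0.                                                      *)
Definition tangent_vector H X : Prop :=
  exists gamma : C -> M,
    [/\ forall z, H (gamma z), gamma 0 = 1,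
        (\forall z \near (0 : C), derivable gamma z 1) & is_derive (0 : C) 1 gamma X].

Definition Lie H : {vspace M} := vspace_of (tangent_vector H).

(* The differential at 1 of a holomorphic map on G; only its values on Lie G *)
(* matter, and they do not depend on the chosen extension.                   *)
Definition dhol G f X : M := 'd (xget f [set E | hol_extension G f 1 E]) (1 : M) X.

Definition dantihol G f X : M := conjm (dhol G (conjm \o f) X).

Definition Kgroup G theta : set M := fixed_points G theta.

Definition kspace G theta : {vspace M} := Lie (Kgroup G theta).

Definition pspace G theta : {vspace M} :=
  vspace_of [set X | X \in Lie G /\ dhol G theta X = - X].

Definition derived_algebra (U : {vspace M}) : {vspace M} :=
  <<[seq lie X Y | X <- vbasis U, Y <- vbasis U]>>%VS.

(* tr (ad X ad Y) on the Lie subalgebra U. *)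
Definition killing (U : {vspace M}) X Y : C :=
  \sum_(i < \dim U) coord (vbasis U) i (lie X (lie Y (tnth (vbasis U) i))).

(* beta is a form on Lie G: its values at other matrices are irrelevant. *)
Record admissible_form G sigma theta (beta : M -> M -> C) : Prop := {
  form_sym : {in Lie G &, forall X Y, beta X Y = beta Y X};
  form_linear : forall a, {in Lie G & &, forall X Y Z,
    beta (a *: X + Y) Z = a * beta X Z + beta Y Z};
  form_killing : {in derived_algebra (Lie G) &, forall X Y,
    beta X Y = killing (derived_algebra (Lie G)) X Y};
  form_pos : {in pspace G theta, forall X,
    dantihol G sigma X = X -> X != 0 -> 0 < beta X X};
  form_neg : {in kspace G theta, forall X,
    dantihol G sigma X = X -> X != 0 -> beta X X < 0};
  form_theta_inv : {in Lie G &, forall X Y,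
    beta (dhol G theta X) (dhol G theta Y) = beta X Y};
  form_K_inv : forall h, Kgroup G theta h -> {in Lie G &, forall X Y,
    beta (Ad h X) (Ad h Y) = beta X Y};
  form_lie_inv : {in Lie G & &, forall Z X Y,
    beta (lie Z X) Y + beta X (lie Z Y) = 0}
}.

(* The complexified Lie algebra g0 = k (+) p0 of the Cartan motion group.    *)
(* In [lie0] and [Ad0] (for h in K) the vectors to which the projections     *)
(* [vsproj] are applied already lie in k, resp. in p.                        *)

Section MotionAlgebra.
Variables (G : set M) (theta : M -> M).
Let k := kspace G theta.
Let p := pspace G theta.

Definition g0 : lmodType C := (subvs_of k * subvs_of p)%type.

Definition lie0 (u v : g0) : g0 :=
  let: (Y1, X1) := u in let: (Y2, X2) := v in
  (vsproj k (lie (vsval Y1) (vsval Y2)),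
   vsproj p (lie (vsval Y1) (vsval X2) + lie (vsval X1) (vsval Y2))).

Definition Ad0 h (u : g0) : g0 :=
  (vsproj k (Ad h (vsval u.1)), vsproj p (Ad h (vsval u.2))).

Definition Ug0 : algType C := uenv lie0.

Definition Z_K (u : Ug0) : Prop :=
  ucentral u /\ (forall h, Kgroup G theta h -> ufixed_by (Ad0 h) u).

Definition p0inj X : Ug0 := uinj lie0 (0, vsproj p X).

Definition gram (beta : M -> M -> C) m (e : m.-tuple M) : 'M[C]_m :=
  \matrix_(i, j) beta (tnth e i) (tnth e j).

(* beta (e'_i) (e_j) = (i == j): the coordinates of e'_i are row i of the    *)
(* inverse Gram matrix.                                                      *)
Definition dual_basis (beta : M -> M -> C) m (e : m.-tuple M) (i : 'I_m) : M :=
  \sum_j invmx (gram beta e) i j *: tnth e j.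

Definition Omega (beta : M -> M -> C) m (e : m.-tuple M) : Ug0 :=
  \sum_i p0inj (dual_basis beta e i) * p0inj (tnth e i).

End MotionAlgebra.

End Setting.

(* Main.v *)
From HB Require Import structures.
Require Import Defs.
From mathcomp Require Import all_boot all_order all_algebra.
From mathcomp Require Import boolp classical_sets reals topology normedtype derive.
Import Order.TTheory GRing.Theory Num.Theory.
Import numFieldNormedType.Exports.
Local Open Scope ring_scope.
Set Implicit Arguments.
Unset Strict Implicit.
Unset Printing Implicit Defensive.

(** The Casimir element is the quadratic element of U(g0) whose coefficient
    matrix is the inverse Gram matrix of beta on p.  Since p0 is abelian, only
    the actions of k (by derivations) and of K (by automorphisms) matter, and
    both transform a quadratic element through their matrices on p; invariance
    of beta makes the inverse Gram matrix infinitesimally, resp. globally,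
    invariant.  The Gram matrix is invertible because beta is positive definite
    on a real form of p: the differential of sigma is a conjugate-linear
    involution of Lie G that commutes with that of theta.  Stability of k and p
    under Ad K is seen on curves, and [k, k] in k and [k, p] in p follow by
    differentiating Ad along a curve in K. *)

(** * Enveloping algebras and quadratic elements *)

Section UniversalEnveloping.
Variables (F : comNzRingType) (L : lmodType F) (bracket : L -> L -> L).
Local Notation U := (uenv bracket).
Local Notation inj := (uinj bracket).

Lemma uinjD x y : inj (x + y) = inj x + inj y.
Proof. by rewrite [RHS]upiD; apply/upiP; constructor. Qed.

Lemma uinjZ a x : inj (a *: x) = a *: inj x.
Proof. by rewrite [RHS]upiM; apply/upiP; constructor. Qed.

Lemma uinj_bracket x y : inj x * inj y = inj y * inj x + inj (bracket x y).
Proof.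
rewrite [inj x * _]upiM [inj y * _]upiM [RHS]upiD.
by apply/upiP; constructor.
Qed.

(** Every element of U(L) is the class of a term built from generators and central constants, and
    the elements commuting with [u] are closed under sums and products. *)
Lemma ucentral_gen (u : U) : (forall x, u * inj x = inj x * u) -> ucentral u.
Proof.
move=> ux; elim/uind; elim=> [x|a|s IHs t IHt|s IHs t IHt].
- exact: ux.
- by rewrite -[upi _ _]/(ucst bracket a) -[LHS]ucst_comm.
- by rewrite -upiD -[uadd _ _]/(upi bracket s + upi bracket t) mulrDr IHs IHt mulrDl.
- by rewrite -upiM -[umul _ _]/(upi bracket s * upi bracket t) mulrA IHs -mulrA IHt mulrA.
Qed.

Fixpoint umap (f : L -> L) (t : uterm F L) : uterm F L :=
  match t with
  | UVar x => UVar (f x)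
  | UCst a => UCst a
  | UAdd s r => UAdd (umap f s) (umap f r)
  | UMul s r => UMul (umap f s) (umap f r)
  end.

(** The universal property for Lie algebra endomorphisms: [umap f] sends each defining relation to a
    relation, so it descends to the quotient. *)
Lemma uenv_lrmorphism (f : L -> L) :
  (forall a x y, f (a *: x + y) = a *: f x + f y) ->
  (forall x y, f (bracket x y) = bracket (f x) (f y)) ->
  exists phi : {lrmorphism U -> U}, forall x, phi (inj x) = inj (f x).
Proof.
move=> flin fB.
have fD x y : f (x + y) = f x + f y by rewrite -[x]scale1r flin !scale1r.
have f0 : f 0 = 0 by apply: (addrI (f 0)); rewrite -fD !addr0.
have fZ a x : f (a *: x) = a *: f x by rewrite -[a *: x]addr0 flin f0 addr0.
have umapP s t : ueq bracket s t -> ueq bracket (umap f s) (umap f t).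
  elim=> /=; try by constructor.
  - by move=> *; apply: ueq_trans; eassumption.
  - by move=> x y; rewrite fD; constructor.
  - by move=> a x; rewrite fZ; constructor.
  - by move=> x y; rewrite fB; constructor.
(* [g] acts on a chosen representative; [gpi] shows that the choice is immaterial. *)
pose g (u : U) : U := upi bracket (umap f (urepr u)).
have gpi t : g (upi bracket t) = upi bracket (umap f t).
  by apply/upiP/umapP; exact: urepr_pi.
have gD u v : g (u + v) = g u + g v.
  elim/uind: u => s; elim/uind: v => t.
  by rewrite [_ + _]upiD !gpi [RHS]upiD.
have gM u v : g (u * v) = g u * g v.
  elim/uind: u => s; elim/uind: v => t.
  by rewrite [_ * _]upiM !gpi [RHS]upiM.
have gc a : g (ucst bracket a) = ucst bracket a by rewrite /ucst gpi.
have gZ a u : g (a *: u) = a *: g u.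
  by rewrite -[a *: u]/(ucst bracket a * u) gM gc.
have gB : zmod_morphism g.
  by move=> u v; rewrite gD -[- v]scaleN1r gZ scaleN1r.
pose phi : {lrmorphism U -> U} := HB.pack g
  (GRing.isZmodMorphism.Build U U g gB)
  (GRing.isMonoidMorphism.Build U U g (conj (gc 1) gM))
  (GRing.isScalable.Build F U U *:%R g gZ).
by exists phi => x; exact: gpi.
Qed.

End UniversalEnveloping.

Section LinearCombinations.
Variables (F : pzRingType) (V : lmodType F) (m : nat).

(** A matrix acting on families of vectors of any module: the same [a] then describes a linear map
    on a basis of p and on the image of that basis in U(g0). *)
Definition lcomb (a : 'M[F]_m) (x : 'I_m -> V) : 'I_m -> V :=
  fun i => \sum_l a i l *: x l.

Lemma lcomb1 x : lcomb 1%:M x = x.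
Proof.
apply/funext => i; rewrite /lcomb (bigD1 i) //= mxE eqxx scale1r.
by rewrite big1 ?addr0 // => j /negPf ji; rewrite mxE eq_sym ji scale0r.
Qed.

End LinearCombinations.

Section QuadraticElements.
Variables (F : comNzRingType) (A : algType F) (m : nat).
Implicit Types (x y : 'I_m -> A) (M a b : 'M[F]_m).

Definition bform M x y : A := \sum_i \sum_j M i j *: (x i * y j).

(** The congruence rule for matrices of bilinear forms, valid for noncommuting [x] because only
    scalars are moved. *)
Lemma bform_lcomb M a b x :
  bform M (lcomb a x) (lcomb b x) = bform (a^T *m M *m b) x x.
Proof.
(* The common full expansion, grouped by the monomials [x k * x l]. *)
pose S := \sum_k \sum_l \sum_i \sum_j (a i k * M i j * b j l) *: (x k * x l).
transitivity S; last first.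
  apply: eq_bigr => k _; apply: eq_bigr => l _.
  rewrite mxE scaler_suml exchange_big; apply: eq_bigr => j _ /=.
  by rewrite -scaler_suml !mxE -mulr_suml; under [in RHS]eq_bigr do rewrite mxE.
rewrite /S; under [RHS]eq_bigr do rewrite exchange_big.
rewrite [RHS]exchange_big; apply: eq_bigr => i _ /=.
under [RHS]eq_bigr do rewrite exchange_big.
rewrite [RHS]exchange_big; apply: eq_bigr => j _ /=.
rewrite /lcomb mulr_suml scaler_sumr; apply: eq_bigr => k _.
rewrite mulr_sumr scaler_sumr; apply: eq_bigr => l _.
rewrite -scalerAl -scalerAr !scalerA.
by rewrite ?mulrA [M i j * _]mulrC.
Qed.

(** The commutator with [u] is a derivation, so it acts on one factor at a time; each of the two
    terms is a change of variables whose other factor is transformed by the identity matrix. *)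
Lemma bform_commutator M c x (u : A) :
    (forall i, u * x i = x i * u + lcomb c x i) ->
  u * bform M x x = bform M x x * u + bform (c^T *m M + M *m c) x x.
Proof.
move=> ux.
have -> : u * bform M x x =
    bform M x x * u + (bform M (lcomb c x) x + bform M x (lcomb c x)).
  rewrite /bform mulr_sumr mulr_suml -!big_split; apply: eq_bigr => i _ /=.
  rewrite mulr_sumr mulr_suml -!big_split; apply: eq_bigr => j _ /=.
  rewrite -scalerAr -scalerAl -!scalerDr; congr (_ *: _).
  by rewrite mulrA ux mulrDl -!mulrA ux mulrDr !mulrA -addrA; congr (_ + _); rewrite addrC.
congr (_ + _).
have -> : bform M (lcomb c x) x = bform (c^T *m M) x x.
  by rewrite -{2}[x]lcomb1 bform_lcomb mulmx1.
have -> : bform M x (lcomb c x) = bform (M *m c) x x.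
  by rewrite -{1}[x]lcomb1 bform_lcomb trmx1 mul1mx.
rewrite /bform -big_split /=; apply: eq_bigr => i _ /=.
under [RHS]eq_bigr do rewrite mxE scalerDl.
by rewrite big_split.
Qed.

End QuadraticElements.

Local Open Scope classical_set_scope.

(** * Limits of matrices and holomorphic curves *)

Section MatrixLimits.
Variables (K : numFieldType).

Lemma cvg_mx (T : Type) (F : set_system T) m n {FF : Filter F}
    (f : T -> 'M[K]_(m, n)) (A : 'M[K]_(m, n)) :
  (forall i j, f x i j @[x --> F] --> A i j) -> f x @[x --> F] --> A.
Proof.
(* A neighbourhood of [A] contains a box [P], that is, finitely many conditions on single
   entries. *)
move=> fA S [P AP sPS].
have FP : \forall x \near F, forall ij : 'I_m * 'I_n, P ij.1 ij.2 (f x ij.1 ij.2).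
  by apply: filter_forall => -[i j]; exact: fA (AP i j).
by apply: filterS FP => x Px; apply: sPS => i j; exact: (Px (i, j)).
Qed.

Lemma cvg_mx_coord (T : Type) (F : set_system T) m n {FF : Filter F}
    (f : T -> 'M[K]_(m, n)) (A : 'M[K]_(m, n)) i j :
  f x @[x --> F] --> A -> f x i j @[x --> F] --> A i j.
Proof. by move=> fA; exact: (cvg_comp _ _ fA (@coord_continuous _ _ _ i j A)). Qed.

Lemma cvg_det (T : Type) (F : set_system T) n {FF : Filter F}
    (f : T -> 'M[K]_n) (A : 'M[K]_n) :
  f x @[x --> F] --> A -> \det (f x) @[x --> F] --> \det A.
Proof.
move=> fA; apply: cvg_big => [|s _]; first exact: add_continuous.
apply: cvgMl_tmp; apply: cvg_big => [|i _]; first exact: mul_continuous.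
exact: cvg_mx_coord.
Qed.

Lemma cvg_mulmx (T : Type) (F : set_system T) m n p {FF : Filter F}
    (f : T -> 'M[K]_(m, n)) (g : T -> 'M[K]_(n, p)) (A : 'M[K]_(m, n)) (B : 'M[K]_(n, p)) :
  f x @[x --> F] --> A -> g x @[x --> F] --> B ->
  f x *m g x @[x --> F] --> A *m B.
Proof.
move=> fA gB; apply: cvg_mx => i j; rewrite mxE.
under eq_fun do rewrite mxE.
apply: cvg_big => [|k _]; first exact: add_continuous.
by apply: cvgM; exact: cvg_mx_coord.
Qed.

(** By the adjugate formula the inverse is rational in the entries, with denominator the
    determinant. *)
Lemma cvg_invmx (T : Type) (F : set_system T) n {FF : Filter F}
    (f : T -> 'M[K]_n) (A : 'M[K]_n) :
  (forall x, f x \in unitmx) -> A \in unitmx ->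
  f x @[x --> F] --> A -> invmx (f x) @[x --> F] --> invmx A.
Proof.
move=> fu Au fA; rewrite /invmx Au; under eq_fun do rewrite fu.
apply: cvgZ; first by apply: cvgV; [rewrite -unitfE -unitmxE | exact: cvg_det].
apply: cvg_mx => i j; rewrite mxE; under eq_fun do rewrite mxE.
apply: cvgMl_tmp; apply: cvg_det; apply: cvg_mx => k l; rewrite !mxE.
by under eq_fun do rewrite !mxE; exact: cvg_mx_coord.
Qed.

Lemma cvg_linear_mx (T : Type) (F : set_system T) m n p q {FF : Filter F}
    (L : {linear 'M[K]_(m, n) -> 'M[K]_(p, q)}) (f : T -> 'M[K]_(m, n))
    (A : 'M[K]_(m, n)) :
  f x @[x --> F] --> A -> L (f x) @[x --> F] --> L A.
Proof.
move=> fA.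
have LE B : L B = \sum_i \sum_j B i j *: L (delta_mx i j).
  rewrite [in LHS](matrix_sum_delta B) linear_sum; apply: eq_bigr => i _.
  by rewrite linear_sum; apply: eq_bigr => j _; rewrite linearZ.
rewrite LE; under eq_fun do rewrite LE.
apply: cvg_big => [|i _]; first exact: add_continuous.
apply: cvg_big => [|j _]; first exact: add_continuous.
by apply: cvgZr_tmp; exact: cvg_mx_coord.
Qed.

Lemma linear_mx_continuous m n p q (L : {linear 'M[K]_(m, n) -> 'M[K]_(p, q)}) :
  continuous L.
Proof. by move=> A; exact: (@cvg_linear_mx _ _ _ _ _ _ (nbhs_filter A) L id). Qed.

(** A subspace is closed: it is the fixed space of a continuous projection, and limits are
    unique. *)
Lemma cvg_vspace (T : Type) (F : set_system T) n {FF : ProperFilter F}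
    (U : {vspace 'M[K]_n}) (f : T -> 'M[K]_n) (A : 'M[K]_n) :
  (forall x, f x \in U) -> f x @[x --> F] --> A -> A \in U.
Proof.
move=> fU fA; suff <- : projv U A = A by exact: memv_proj.
have pA : projv U (f x) @[x --> F] --> projv U A.
  exact: cvg_linear_mx.
have {}pA : f x @[x --> F] --> projv U A.
  apply: cvg_trans pA; apply: near_eq_cvg.
  by apply: nearW => x; rewrite projv_id.
exact: (cvg_unique (@norm_hausdorff K _) pA fA).
Qed.

Lemma is_derive1E (V : normedModType K) (F : K -> V) (z : K) (X : V) :
  is_derive z 1 F X <-> h^-1 *: (F (h + z) - F z) @[h --> 0^'] --> X.
Proof.
have -> : (fun h : K => h^-1 *: (F (h + z) - F z)) =
    (fun h => h^-1 *: ((F \o shift z) (h *: 1) - F z)).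
  by apply/funext => h /=; rewrite /GRing.scale /= mulr1.
split=> [[FX <-]|FX]; first exact: FX.
by split; [apply/cvg_ex; exists X | exact: cvg_lim FX].
Qed.

Lemma is_derive1_comp (V W : normedModType K) (F : K -> V) (E : V -> W) (z : K) X :
  is_derive z 1 F X -> differentiable E (F z) ->
  is_derive z 1 (E \o F) ('d E (F z) X).
Proof.
move=> [dF <-] dE.
have dF' : differentiable F z by apply/derivable1_diffP.
have dEF : differentiable (E \o F) z by exact: differentiable_comp.
split; first exact/derivable1_diffP.
by rewrite !deriveE // diff_comp.
Qed.

End MatrixLimits.

(** * Holomorphic curves and their velocities *)

Section Curves.
Variables (R : realType) (n : nat).
Local Notation C := (Cx R).
Local Notation M := 'M[C]_n.+1.
Implicit Types (G H : set M) (f gamma : M -> M) (g h X Y Z : M) (F : C -> M).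

Definition curve_at0 F X : Prop :=
  (\forall z \near (0 : C), derivable F z 1) /\ is_derive (0 : C) 1 F X.

Lemma conjC_continuous : continuous (Num.conj : C -> C).
Proof.
move=> z A /nbhs_ballP[e /= e0 eA]; apply/nbhs_ballP; exists e => //= t zt.
by apply: eA; rewrite /ball /= -rmorphB norm_conjC.
Qed.

Lemma cvg_conjm (T : Type) (F : set_system T) {FF : Filter F} (f : T -> M) X :
  f x @[x --> F] --> X -> conjm (f x) @[x --> F] --> conjm X.
Proof.
move=> fX; apply: cvg_mx => i j; rewrite mxE; under eq_fun do rewrite mxE.
exact: (cvg_comp _ _ (cvg_mx_coord fX) (@conjC_continuous (X i j))).
Qed.

Lemma conjmK : involutive (@conjm R n).
Proof. by move=> X; apply/matrixP => i j; rewrite !mxE conjCK. Qed.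

Lemma conjmZ (a : C) X : conjm (a *: X) = a^* *: conjm X.
Proof. exact: map_mxZ. Qed.

Lemma conjmD X Y : conjm (X + Y) = conjm X + conjm Y.
Proof. exact: map_mxD. Qed.

Lemma conjmB X Y : conjm (X - Y) = conjm X - conjm Y.
Proof. exact: map_mxB. Qed.

(** Conjugating both argument and value preserves holomorphy: the new difference quotient at [h] is
    the conjugate of the old one at [h^*]. *)
Lemma is_derive_conj F (z : C) X :
  is_derive (z^*) 1 F X -> is_derive z 1 (fun w : C => conjm (F w^*)) (conjm X).
Proof.
move=> /is_derive1E FX; apply/is_derive1E.
have c0 : (h : C)^* @[h --> 0^'] --> (0 : C)^'.
  move=> A [e /= e0 eA]; exists e => //= h /= he h0; apply: eA => /=.
    by move: he; rewrite /= !sub0r !normrN norm_conjC.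
  by rewrite conjC_eq0.
have q := cvg_conjm (cvg_comp _ _ c0 FX).
rewrite [X in X @ _ --> _](_ : _ =
  fun h : C => conjm ((h^*)^-1 *: (F (h^* + z^*) - F z^*))); first exact: q.
by apply/funext => h; rewrite conjmZ conjmB fmorphV /= conjCK rmorphD.
Qed.

Lemma near0_conj (P : C -> Prop) :
  (\forall z \near (0 : C), P z) -> \forall z \near (0 : C), P z^*.
Proof.
have c0 : (z : C)^* @[z --> 0] --> (0 : C).
  by have := @conjC_continuous 0; rewrite /continuous_at conjC0.
exact: c0.
Qed.

Lemma curve_conj F X :
  curve_at0 F X -> curve_at0 (fun w : C => conjm (F w^*)) (conjm X).
Proof.
move=> [dF FX]; split; last by apply: is_derive_conj; rewrite conjC0.
apply: filterS (near0_conj dF) => z /derivableP dFz.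
exact: (@ex_derive _ _ _ _ _ _ _ (is_derive_conj dFz)).
Qed.

(** [f] and [E] are kept apart because a map holomorphic on G agrees with its local extension only
    on G, hence only along the curve. *)
Lemma curve_comp_near F (E f : M -> M) X :
    curve_at0 F X -> (\forall x \near F 0, differentiable E x) ->
    (\forall z \near (0 : C), f (F z) = E (F z)) ->
  curve_at0 (f \o F) ('d E (F 0) X).
Proof.
move=> [dF FX] dE fE.
have cF : F z @[z --> (0 : C)] --> F 0.
  by apply: differentiable_continuous; apply/derivable1_diffP; exact: ex_derive.
have fE' : \forall z \near (0 : C), (E \o F) z = (f \o F) z.
  by apply: filterS fE => z /= ->.
split; last first.
  apply: near_eq_is_derive fE' _.
  by apply: is_derive1_comp; exact: nbhs_singleton dE.
have dEF : \forall z \near (0 : C), differentiable E (F z) by exact: cF dE.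
(* Derivability of [f \o F] at a nearby [z] needs the equality with [E \o F] on a whole
   neighbourhood of [z], which [near_join] provides. *)
apply: filterS3 dF dEF (near_join fE') => z /derivableP dFz dEz fEz.
exact: (@ex_derive _ _ _ _ _ _ _ (near_eq_is_derive fEz (is_derive1_comp dFz dEz))).
Qed.

Lemma curve_comp_linear F (L : {linear M -> M}) X :
  curve_at0 F X -> curve_at0 (L \o F) (L X).
Proof.
have Lc := @linear_mx_continuous C _ _ _ _ L.
move=> FX; rewrite -[L X](congr1 (@^~ X) (diff_lin (F 0) Lc)).
apply: (curve_comp_near (f := L) FX); last by apply: filterE.
by apply: (filterE (nbhs_filter (F 0))) => x; exact: linear_differentiable.
Qed.

(** This ties [dhol], defined through an arbitrarily chosen extension, to [f] itself. Identities
    between differentials then follow by comparing velocities of equal curves, with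
    [curve_unique]. *)
Lemma curve_comp_holomorphic G f F X : holomorphic_on G f ->
    (forall z, G (F z)) -> F 0 = 1 -> curve_at0 F X ->
  curve_at0 (f \o F) (dhol G f X).
Proof.
move=> fhol GF F0 FX.
have G1 : G 1 by rewrite -F0.
rewrite /dhol; have := xgetPex f (fhol 1 G1).
set E := xget _ _ => -[dE fE]; rewrite -F0 in dE fE *.
apply: curve_comp_near => //.
have cF : F z @[z --> (0 : C)] --> F 0.
  by apply: differentiable_continuous; apply/derivable1_diffP; case: FX => _ [].
have fE' : \forall z \near (0 : C), G (F z) -> f (F z) = E (F z) by exact: cF fE.
by apply: filterS fE' => z; apply.
Qed.

Lemma curve_unique F X Y : curve_at0 F X -> curve_at0 F Y -> X = Y.
Proof. by move=> [_ [_ <-]] [_ [_ <-]]. Qed.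

Lemma tangent_vectorP H X :
  tangent_vector H X <->
  exists F, [/\ forall z, H (F z), F 0 = 1 & curve_at0 F X].
Proof.
split=> [[F [HF F0 dF FX]]|[F [HF F0 [dF FX]]]]; exists F; by split.
Qed.

(** Both cases are carried along for [Lie], which avoids proving that tangent vectors form a
    subspace. *)
Lemma vspace_ofP (P : set M) :
  (forall X, X \in vspace_of P <-> P X) \/ vspace_of P = 0%VS.
Proof.
rewrite /vspace_of; case: xgetP => [U -> PU|_]; by [left|right].
Qed.

Lemma LieP H : (forall X, X \in Lie H <-> tangent_vector H X) \/ Lie H = 0%VS.
Proof. exact: vspace_ofP. Qed.

(** A nonzero element rules out the default value 0 of [Lie H]; this is why later proofs treat the
    zero vector separately. *)
Lemma Lie_tangent H X : X \in Lie H -> X != 0 -> tangent_vector H X.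
Proof.
have [P|->] := LieP H; first by move/P.
by rewrite memv0 => ->.
Qed.

End Curves.
(** * The decomposition of Lie G *)

Section LieAlgebra.
Variables (R : realType) (n : nat).
Local Notation C := (Cx R).
Local Notation M := 'M[C]_n.+1.
Implicit Types (G H : set M) (g h X Y Z : M).

Lemma AdZD h (a : C) X Y : Ad h (a *: X + Y) = a *: Ad h X + Ad h Y.
Proof. by rewrite /Ad mulrDr mulrDl -scalerAr -scalerAl. Qed.

Lemma AdD h X Y : Ad h (X + Y) = Ad h X + Ad h Y.
Proof. by rewrite /Ad mulrDr mulrDl. Qed.

Lemma Ad0r h : Ad h 0 = 0.
Proof. by rewrite /Ad mulr0 mul0r. Qed.

Lemma AdM h X Y : h \is a GRing.unit -> Ad h (X * Y) = Ad h X * Ad h Y.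
Proof. by move=> hu; rewrite /Ad -!mulrA mulKr. Qed.

Lemma Ad_lie h X Y : h \is a GRing.unit -> Ad h (lie X Y) = lie (Ad h X) (Ad h Y).
Proof. by move=> hu; rewrite /lie -!AdM // /Ad mulrBr mulrBl. Qed.

Lemma lie0r X : lie X 0 = 0.
Proof. by rewrite /lie mulr0 mul0r subrr. Qed.

Lemma lie0l X : lie 0 X = 0.
Proof. by rewrite /lie mulr0 mul0r subrr. Qed.

Lemma eq_curve (F F' : C -> M) X : F =1 F' -> curve_at0 F X -> curve_at0 F' X.
Proof. by move/funext->. Qed.

Lemma curve_Ad h (F : C -> M) X : curve_at0 F X -> curve_at0 (Ad h \o F) (Ad h X).
Proof.
exact: (@curve_comp_linear _ _ F (mulmxr (h^-1) \o mulmx h)%FUN).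
Qed.

Lemma tangent_Ad H h X : h \is a GRing.unit ->
  (forall g, H g -> H (h * g * h^-1)) ->
  tangent_vector H X -> tangent_vector H (Ad h X).
Proof.
move=> hu Hh /tangent_vectorP[F [HF F0 FX]]; apply/tangent_vectorP.
exists (Ad h \o F); split; last exact: curve_Ad.
- by move=> z; exact: Hh.
- by rewrite /= F0 /Ad mulr1 divrr.
Qed.

Lemma Lie_Ad H h X : h \is a GRing.unit ->
  (forall g, H g -> H (h * g * h^-1)) -> X \in Lie H -> Ad h X \in Lie H.
Proof.
move=> hu Hh; have [HP|->] := LieP H.
  by move=> /HP /(tangent_Ad hu Hh) /HP.
by rewrite memv0 => /eqP->; rewrite Ad0r mem0v.
Qed.

(* [X, Y] is the derivative at 0 of Ad (F z) Y, where F is a curve with velocity X. *)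
Lemma lie_stable H (U : {vspace M}) X Y :
    (forall g, H g -> g \is a GRing.unit) -> tangent_vector H X ->
    (forall g, H g -> Ad g Y \in U) -> Y \in U ->
  lie X Y \in U.
Proof.
move=> Hu /tangent_vectorP[F [HF F0 [_ FX]]] HY YU.
pose D : C -> M := fun z => z^-1 *: (F (z + 0) - F 0).
have DX : D z @[z --> 0^'] --> X by move/is_derive1E : FX.
have cF : invmx (F z) @[z --> (0 : C)^'] --> invmx (1 : M).
  apply: cvg_invmx => [z||]; [exact: Hu | exact: unitmx1 |].
  have cF0 : F z @[z --> (0 : C)] --> F 0.
    apply: differentiable_continuous.
    by apply/derivable1_diffP; exact: ex_derive.
  by rewrite -F0 => A /cF0; exact: nbhs_dnbhs.
have FF : Filter (0 : C)^' by exact: dnbhs_filter.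
have cY : (fun=> Y) z @[z --> (0 : C)^'] --> Y by exact: cvg_cst.
have c1 := cvg_mulmx (FF := FF) DX cY; have c2 := cvg_mulmx (FF := FF) cY DX.
have VX := cvg_mulmx (FF := FF) (cvgB (FF := FF) c1 c2) cF.
rewrite invmx1 mulmx1 in VX.
apply: cvg_vspace VX.
move=> z; have Fu := Hu _ (HF z).
(* The expression converging to [lie X Y] is the difference quotient of Ad along the curve, and so
   takes its values in [U]. *)
suff -> : (D z *m Y - Y *m D z) *m invmx (F z) = z^-1 *: (Ad (F z) Y - Y).
  by rewrite memvZ // memvB // HY.
rewrite /D F0 addr0 /Ad.
change ((z^-1 *: (F z - 1) * Y - Y * (z^-1 *: (F z - 1))) * (F z)^-1 =
  z^-1 *: (F z * Y * (F z)^-1 - Y)).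
have -> : z^-1 *: (F z - 1) * Y - Y * (z^-1 *: (F z - 1)) =
    z^-1 *: (F z * Y - Y * F z).
  rewrite -scalerAl -scalerAr -scalerBr mulrBl mulrBr mulr1 mul1r.
  by rewrite opprB addrA subrK.
by rewrite -scalerAl mulrBl mulrK.
Qed.

Lemma dhol_linear G (f : M -> M) : linear (dhol G f).
Proof. by move=> a X Y; rewrite /dhol linearP. Qed.

Lemma dhol0 G (f : M -> M) : dhol G f 0 = 0.
Proof. by rewrite /dhol linear0. Qed.

(** No default case arises here: the condition cuts out the intersection of the subspace [Lie G]
    with the kernel of a linear map. *)
Lemma pspaceP G (theta : M -> M) X :
  X \in pspace G theta <-> X \in Lie G /\ dhol G theta X = - X.
Proof.
suff [U UP] : exists U : {vspace M},
    forall X, X \in U <-> X \in Lie G /\ dhol G theta X = - X.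
  rewrite /pspace /vspace_of; case: xgetP => [V -> VP|/(_ U)]; first exact: VP.
  by move=> nU; case: (nU UP).
pose D : {linear M -> M} := 'd (xget theta [set E | hol_extension G theta 1 E]) (1 : M).
exists (Lie G :&: lker (linfun D + \1%VF)%R)%VS => Z.
rewrite memv_cap memv_ker add_lfunE lfunE id_lfunE addr_eq0.
by split=> [/andP[-> /eqP]|[-> /eqP]].
Qed.


(** * Stability of k and p, and nondegeneracy of beta on p *)

Section Setting.
Variables (G : set M) (sigma theta : M -> M) (beta : M -> M -> C).
Hypotheses (G_algebraic : algebraic_group G)
  (sigma_antiholomorphic : antiholomorphic_involution G sigma)
  (theta_cartan : cartan_involution G sigma theta)
  (beta_form : admissible_form G sigma theta beta).
Local Notation K := (Kgroup G theta).
Local Notation k := (kspace G theta).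
Local Notation p := (pspace G theta).

Lemma G_unit g : G g -> g \is a GRing.unit.
Proof. by have [[S GS] _ _ _] := G_algebraic; case/GS. Qed.

Lemma K_unit h : K h -> h \is a GRing.unit.
Proof. by case=> /G_unit. Qed.

Lemma involution1 (f : M -> M) : group_involution G f -> f 1 = 1.
Proof.
have [_ G1 _ _] := G_algebraic; case=> fG fM _.
by apply: (mulrI (G_unit (fG _ G1))); rewrite -fM // !mulr1.
Qed.

Lemma involutionV (f : M -> M) g : group_involution G f -> G g -> f g^-1 = (f g)^-1.
Proof.
have [_ G1 _ GV] := G_algebraic => fi Gg; have [fG fM _] := fi.
apply: (mulrI (G_unit (fG _ Gg))); rewrite -fM //; last exact: GV.
by rewrite !divrr ?involution1 ?G_unit //; exact: fG.
Qed.

Lemma G_conj h g : G h -> G g -> G (h * g * h^-1).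
Proof. by have [_ _ GM GV] := G_algebraic => Gh Gg; exact: GM (GM _ _ Gh Gg) (GV _ Gh). Qed.

Lemma theta_conj h g : K h -> G g -> theta (h * g * h^-1) = h * theta g * h^-1.
Proof.
have [_ _ GM GV] := G_algebraic; have [ti _ _ _] := theta_cartan.
have [_ tM _] := ti => -[Gh th] Gg.
by rewrite (tM _ _ (GM _ _ Gh Gg) (GV _ Gh)) (tM _ _ Gh Gg) (involutionV ti Gh) th.
Qed.

Lemma K_conj h g : K h -> K g -> K (h * g * h^-1).
Proof.
move=> Kh [Gg tg]; split; first by apply: G_conj => //; case: Kh.
by rewrite theta_conj ?tg.
Qed.

Lemma tangent_KG X : tangent_vector K X -> tangent_vector G X.
Proof. by case=> F [KF F0 dF FX]; exists F; split=> // z; case: (KF z). Qed.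

(** As theta fixes [h], it commutes with conjugation by [h] on G; both sides are velocities of one
    curve. *)
Lemma dhol_theta_Ad h X : K h -> tangent_vector G X ->
  dhol G theta (Ad h X) = Ad h (dhol G theta X).
Proof.
move=> Kh /tangent_vectorP[F [GF F0 FX]]; have [_ thol _ _] := theta_cartan.
have c1 := curve_Ad h (curve_comp_holomorphic thol GF F0 FX).
have GF' z : G ((Ad h \o F) z) by apply: G_conj => //; case: Kh.
have F0' : (Ad h \o F) 0 = 1 by rewrite /= F0 /Ad mulr1 divrr // K_unit.
have c2 := curve_comp_holomorphic thol GF' F0' (curve_Ad h FX).
apply: curve_unique c2 _; rewrite (_ : theta \o _ = Ad h \o (theta \o F)) //.
by apply/funext => z; exact: theta_conj.
Qed.

Lemma k_Ad h X : K h -> X \in k -> Ad h X \in k.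
Proof. by move=> Kh; apply: Lie_Ad; [exact: K_unit | move=> g; exact: K_conj]. Qed.

Lemma p_Ad h X : K h -> X \in p -> Ad h X \in p.
Proof.
move=> Kh; have [->|X0] := eqVneq X 0; first by rewrite Ad0r mem0v.
have [Gh _] := Kh => /pspaceP[GX tX]; apply/pspaceP; split.
  by apply: Lie_Ad GX => [|g]; [exact: G_unit | exact: G_conj].
rewrite dhol_theta_Ad //; last exact: Lie_tangent GX X0.
by rewrite tX /Ad mulrN mulNr.
Qed.

Lemma k_lie X Y : X \in k -> Y \in k -> lie X Y \in k.
Proof.
have [->|X0] := eqVneq X 0; first by move=> *; rewrite lie0l mem0v.
move=> kX kY; apply: (lie_stable K_unit (Lie_tangent kX X0)) => // h Kh.
exact: k_Ad.
Qed.

Lemma p_lie X Y : X \in k -> Y \in p -> lie X Y \in p.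
Proof.
have [->|X0] := eqVneq X 0; first by move=> *; rewrite lie0l mem0v.
move=> kX pY; apply: (lie_stable K_unit (Lie_tangent kX X0)) => // h Kh.
exact: p_Ad.
Qed.

Lemma p_sub X : X \in p -> X \in Lie G.
Proof. by case/pspaceP. Qed.

(* If the tangent vectors of G did not form a subspace, then [Lie G], and with
   it p, would be 0. *)
Lemma k_sub X Y : X \in k -> Y \in p -> Y != 0 -> X \in Lie G.
Proof.
move=> kX /p_sub GY Y0; have [P|L0] := LieP G; last first.
  by move: GY; rewrite L0 memv0 (negPf Y0).
have [->|X0] := eqVneq X 0; first exact: mem0v.
by apply/P/tangent_KG; exact: Lie_tangent kX X0.
Qed.

(** Conjugating the parameter compensates the antiholomorphy of sigma, so this is again a
    holomorphic curve in G. *)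
Lemma curve_sigma (F : C -> M) X :
    (forall z, G (F z)) -> F 0 = 1 -> curve_at0 F X ->
  curve_at0 (fun w : C => sigma (F w^*)) (dantihol G sigma X).
Proof.
move=> GF F0 FX; have [_ shol] := sigma_antiholomorphic.
apply: eq_curve (curve_conj (curve_comp_holomorphic shol GF F0 FX)) => w.
exact: conjmK.
Qed.

Lemma tangent_dantihol X : tangent_vector G X ->
  tangent_vector G (dantihol G sigma X).
Proof.
move=> /tangent_vectorP[F [GF F0 FX]]; have [si _] := sigma_antiholomorphic.
have [sG _ _] := si; apply/tangent_vectorP; exists (fun w : C => sigma (F w^*)).
split; last exact: curve_sigma.
- by move=> z; exact: sG.
- by rewrite conjC0 F0 involution1.
Qed.

Lemma dantiholK X : tangent_vector G X ->
  dantihol G sigma (dantihol G sigma X) = X.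
Proof.
move=> /tangent_vectorP[F [GF F0 FX]]; have [si _] := sigma_antiholomorphic.
have [sG _ sK] := si; apply: (curve_unique _ FX).
have F0' : sigma (F 0^*) = 1 by rewrite conjC0 F0 involution1.
have GF' z : G (sigma (F z^*)) by exact: sG.
apply: eq_curve (curve_sigma GF' F0' (curve_sigma GF F0 FX)) => w.
by rewrite conjCK sK.
Qed.

Lemma dhol_dantihol X : tangent_vector G X ->
  dhol G theta (dantihol G sigma X) = dantihol G sigma (dhol G theta X).
Proof.
move=> /tangent_vectorP[F [GF F0 FX]]; have [si _] := sigma_antiholomorphic.
have [sG _ _] := si; have [ti thol st _] := theta_cartan; have [tG _ _] := ti.
have c1 : curve_at0 (fun w : C => sigma ((theta \o F) w^*)) (dantihol G sigma (dhol G theta X)).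
  apply: curve_sigma; [by move=> z; exact: tG | by rewrite /= F0 involution1 |].
  exact: curve_comp_holomorphic.
apply: curve_unique c1.
have F0' : sigma (F 0^*) = 1 by rewrite conjC0 F0 involution1.
have GF' z : G (sigma (F z^*)) by exact: sG.
apply: eq_curve (curve_comp_holomorphic thol GF' F0' (curve_sigma GF F0 FX)) => w.
by rewrite /= st.
Qed.

Lemma dantihol_semilinear (a : C) X Y :
  dantihol G sigma (a *: X + Y) = a^* *: dantihol G sigma X + dantihol G sigma Y.
Proof. by rewrite /dantihol dhol_linear conjmD conjmZ. Qed.

Lemma dantihol0 : dantihol G sigma 0 = 0.
Proof. by rewrite /dantihol dhol0 /conjm map_mx0. Qed.

Lemma p_sigma X : X \in p -> dantihol G sigma X \in p.
Proof.
have [->|X0] := eqVneq X 0; first by rewrite dantihol0 mem0v.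
move=> pX; have GX := p_sub pX; have tX := Lie_tangent GX X0.
move/pspaceP: pX => [_ tpX]; apply/pspaceP; split.
  have [P|L0] := LieP G; first by apply/P; exact: tangent_dantihol.
  by move: GX; rewrite L0 memv0 (negPf X0).
rewrite dhol_dantihol // tpX.
by rewrite -[- X]addr0 -scaleN1r dantihol_semilinear dantihol0 addr0 rmorphN1 scaleN1r.
Qed.

Lemma beta_linear_l (a : C) X Y Z : X \in Lie G -> Y \in Lie G -> Z \in Lie G ->
  beta (a *: X + Y) Z = a * beta X Z + beta Y Z.
Proof. by move=> *; apply: (form_linear beta_form). Qed.

Lemma beta_linear_r (a : C) X Y Z : X \in Lie G -> Y \in Lie G -> Z \in Lie G ->
  beta Z (a *: X + Y) = a * beta Z X + beta Z Y.
Proof.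
move=> GX GY GZ; have sym := form_sym beta_form.
by rewrite sym ?beta_linear_l ?(sym Z) // memvD ?memvZ.
Qed.

Lemma beta0l Z : Z \in Lie G -> beta 0 Z = 0.
Proof.
move=> GZ; have := @beta_linear_l (-1) 0 0 Z (mem0v _) (mem0v _) GZ.
by rewrite scaler0 addr0 mulN1r addNr.
Qed.

(* p is the complexification of its sigma-fixed real form, on which beta is
   positive definite: for A and B in that real form,
   beta (A - iB, A + iB) = beta (A, A) + beta (B, B). *)
Lemma beta_nondegenerate X : X \in p -> {in p, forall Y, beta X Y = 0} -> X = 0.
Proof.
move=> pX bX; apply/eqP/negPn/negP => X0.
pose s := dantihol G sigma X.
have ps : s \in p by exact: p_sigma.
have sX : dantihol G sigma s = X by apply: dantiholK; exact: Lie_tangent (p_sub pX) X0.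
(* A = X + s and B = i(X - s), with s the image of X, are sigma-fixed and A - iB = 2X; the redundant
   1, -1 and 0 fit the shape required by [dantihol_semilinear]. *)
pose A := 1 *: X + s; pose B := 'i *: (-1 *: s + X) + 0.
have pA : A \in p by rewrite memvD ?memvZ.
have pB : B \in p by rewrite /B addr0 memvZ // memvD // memvZ.
have sA : dantihol G sigma A = A.
  by rewrite dantihol_semilinear sX rmorph1 -/s /A !scale1r addrC.
have sB : dantihol G sigma B = B.
  rewrite /B dantihol_semilinear dantihol0 dantihol_semilinear sX -/s rmorphN1 conjCi.
  by rewrite !addr0 !scaleN1r scaleNr -scalerN opprD opprK addrC.
have pos Y : Y \in p -> dantihol G sigma Y = Y -> 0 <= beta Y Y ?= iff (Y == 0).
  move=> pY sY; have [->|Y0] := eqVneq Y 0; first by rewrite beta0l ?mem0v //; split; rewrite ?lexx ?eqxx.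
  have b0 := form_pos beta_form pY sY Y0.
  by split; [exact: ltW | rewrite lt_eqF].
have XE : - 'i *: B + A = 2 *: X.
  rewrite /A /B addr0 scalerA mulNr -expr2 sqrCi opprK !scale1r scaleN1r.
  by rewrite [X + s]addrC addrACA addNr add0r scaler_nat mulr2n.
clearbody A B; have GA := p_sub pA; have GB := p_sub pB.
have bAB : beta (- 'i *: B + A) ('i *: B + A) = beta A A + beta B B.
  have GY : 'i *: B + A \in Lie G by rewrite memvD ?memvZ.
  rewrite beta_linear_l // !beta_linear_r // (form_sym beta_form GA GB).
  rewrite mulrDr mulrA mulNr -expr2 sqrCi opprK mul1r mulNr.
  by rewrite addrA subrK addrC.
(* The first argument is 2X, which is orthogonal to p. *)
have b0 : beta (- 'i *: B + A) ('i *: B + A) = 0.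
  have pY : 'i *: B + A \in p by rewrite memvD ?memvZ.
  have GY := p_sub pY; have GX := p_sub pX.
  by rewrite XE -[2 *: X]addr0 beta_linear_l ?beta0l ?bX ?mulr0 ?addr0 ?mem0v.
move: bAB; rewrite b0 => /esym/eqP.
rewrite paddr_eq0 ?(pos A) ?(pos B) // -!(eq_sym 0) !(pos A, pos B) //.
move=> /andP[/eqP A0 /eqP B0]; move/eqP: XE.
by rewrite A0 B0 scaler0 addr0 eq_sym scaler_eq0 (negPf X0) pnatr_eq0.
Qed.

End Setting.

End LieAlgebra.

(** * The Casimir element *)

Section InverseGram.
Variables (F : fieldType) (m : nat).
Implicit Types B a c : 'M[F]_m.

(** The hypothesis exhibits B a^T B^-1 as a right inverse of [a], hence as a left inverse: a^T B^-1
    a = B^-1. Transpose. *)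
Lemma invmx_isometry B a : B \in unitmx -> a *m B *m a^T = B ->
  a^T *m (invmx B)^T *m a = (invmx B)^T.
Proof.
move=> Bu aB; have /mulmx1C : a *m (B *m a^T *m invmx B) = 1%:M.
  by rewrite !mulmxA aB mulmxV.
rewrite -!mulmxA => /(congr1 (mulmx (invmx B))); rewrite mulKmx // mulmx1 => aBa.
by rewrite -[in RHS]aBa !trmx_mul trmxK mulmxA.
Qed.

(** The infinitesimal counterpart: multiply the hypothesis by B^-1 on both sides and transpose. *)
Lemma invmx_derivation B c : B \in unitmx -> c *m B + B *m c^T = 0 ->
  c^T *m (invmx B)^T + (invmx B)^T *m c = 0.
Proof.
move=> Bu cB; apply: trmx_inj; rewrite trmx0 linearD /= !trmx_mul !trmxK.
have -> : invmx B *m c + c^T *m invmx B =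
    invmx B *m (c *m B + B *m c^T) *m invmx B.
  by rewrite mulmxDr mulmxDl !mulmxA mulmxK // mulVmx // mul1mx.
by rewrite cB mulmx0 mul0mx.
Qed.

End InverseGram.

(** * Centrality and K-invariance *)

Section Casimir.
Variables (R : realType) (n : nat).
Local Notation C := (Cx R).
Local Notation M := 'M[C]_n.+1.
Variables (G : set M) (sigma theta : M -> M) (beta : M -> M -> C).
Hypotheses (G_algebraic : algebraic_group G)
  (sigma_antiholomorphic : antiholomorphic_involution G sigma)
  (theta_cartan : cartan_involution G sigma theta)
  (beta_form : admissible_form G sigma theta beta).
Local Notation K := (Kgroup G theta).
Local Notation k := (kspace G theta).
Local Notation p := (pspace G theta).
Local Notation U := (Ug0 G theta).
Variable e : (\dim p).-tuple M.
Hypothesis e_basis : basis_of p e.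
Local Notation m := (\dim p).
Local Notation B := (gram beta e).
Local Notation p0e := (fun i : 'I_m => p0inj G theta (tnth e i)).

Lemma p_basis i : tnth e i \in p.
Proof. exact: (basis_mem e_basis (mem_tnth i e)). Qed.

Lemma G_basis i : tnth e i \in Lie G.
Proof. exact: p_sub (p_basis i). Qed.

Lemma lcomb_basis (f : M -> M) : (forall i, f (tnth e i) \in p) ->
  exists c : 'M[C]_m, forall i, f (tnth e i) = lcomb c (tnth e) i.
Proof.
move=> pf; exists (\matrix_(i, j) coord e j (f (tnth e i))) => i.
rewrite {1}(coord_basis e_basis (pf i)); apply: eq_bigr => j _.
by rewrite mxE -tnth_nth.
Qed.

Lemma beta_sum_l (a : 'I_m -> C) (y : 'I_m -> M) Z :
    (forall i, y i \in Lie G) -> Z \in Lie G ->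
  beta (\sum_i a i *: y i) Z = \sum_i a i * beta (y i) Z.
Proof.
move=> Gy GZ; elim: (index_enum _) => [|i s IHs]; first by rewrite !big_nil (beta0l beta_form).
rewrite !big_cons (beta_linear_l beta_form) ?IHs //.
by rewrite rpred_sum // => j _; rewrite memvZ.
Qed.

Lemma G_lcomb a i : lcomb a (tnth e) i \in Lie G.
Proof. by rewrite rpred_sum // => j _; rewrite memvZ ?G_basis. Qed.

Lemma beta_lcomb (a b : 'M[C]_m) i j :
  beta (lcomb a (tnth e) i) (lcomb b (tnth e) j) = (a *m B *m b^T) i j.
Proof.
rewrite beta_sum_l ?G_lcomb //; last exact: G_basis.
rewrite -mulmxA mxE; apply: eq_bigr => l _; congr (_ * _).
rewrite (form_sym beta_form) ?G_lcomb ?G_basis // beta_sum_l ?G_basis //; last exact: G_basis.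
rewrite mxE; apply: eq_bigr => r _.
by rewrite !mxE mulrC (form_sym beta_form) ?G_basis.
Qed.

(** A row vector killed by the Gram matrix gives an element of p orthogonal to the basis, hence to
    p, so it vanishes by nondegeneracy; freeness of the basis concludes. *)
Lemma gram_unit : B \in unitmx.
Proof.
rewrite -row_free_unit; apply/inj_row_free => v vB.
pose X := \sum_i v 0 i *: tnth e i.
have pX : X \in p by rewrite rpred_sum // => i _; rewrite memvZ ?p_basis.
have bXe i : beta X (tnth e i) = 0.
  rewrite beta_sum_l ?G_basis //; last exact: G_basis.
  have /rowP/(_ i) := vB; rewrite !mxE => vBi; rewrite -[RHS]vBi.
  by apply: eq_bigr => j _; rewrite mxE.
have X0 : X = 0.
  apply: (beta_nondegenerate G_algebraic sigma_antiholomorphic theta_cartan beta_form pX).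
  move=> Y pY; rewrite (coord_basis e_basis pY) (form_sym beta_form) ?(p_sub pX) //; last first.
    by rewrite rpred_sum // => i _; rewrite memvZ // -tnth_nth G_basis.
  under eq_bigr do rewrite -tnth_nth.
  rewrite beta_sum_l ?(p_sub pX) //; last exact: G_basis.
  by rewrite big1 // => i _; rewrite (form_sym beta_form) ?G_basis ?(p_sub pX) // bXe mulr0.
apply/rowP => i; rewrite mxE.
have /freeP := basis_free e_basis; apply.
by rewrite -[RHS]X0; apply: eq_bigr => j _; rewrite -tnth_nth.
Qed.

Lemma p0inj_lcomb (a : 'M[C]_m) i : p0inj G theta (lcomb a (tnth e) i) = lcomb a p0e i.
Proof.
have p0D X Y : p0inj G theta (X + Y) = p0inj G theta X + p0inj G theta Y.
  by rewrite /p0inj -uinjD linearD; congr uinj; congr pair; rewrite addr0.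
have p0Z (c : C) X : p0inj G theta (c *: X) = c *: p0inj G theta X.
  by rewrite /p0inj -uinjZ linearZ; congr uinj; congr pair; rewrite scaler0.
rewrite /lcomb; elim: (index_enum _) => [|j s IHs].
  by rewrite !big_nil -[X in p0inj _ _ X](scale0r 0) p0Z scale0r.
by rewrite !big_cons p0D p0Z IHs.
Qed.

(** The transpose appears because the dual vector, expanded along row i of the inverse, stands to
    the left of e_i. *)
Lemma Omega_bform : Omega G theta beta e = bform (invmx B)^T p0e p0e.
Proof.
rewrite /Omega /bform exchange_big; apply: eq_bigr => i _ /=.
rewrite (p0inj_lcomb (invmx B)) /lcomb mulr_suml; apply: eq_bigr => j _.
by rewrite mxE scalerAl.
Qed.

Lemma Omega_central : ucentral (Omega G theta beta e).
Proof.
apply: ucentral_gen => -[Y X]; apply/esym.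
(* [c] is the matrix of ad Y on p; the p-component X of the generator drops out of the commutators
   below, p0 being abelian. *)
have [c cE] : exists c : 'M[C]_m, forall i, lie (vsval Y) (tnth e i) = lcomb c (tnth e) i.
  by apply: lcomb_basis => i; exact: (p_lie G_algebraic theta_cartan (subvsP Y) (p_basis i)).
rewrite Omega_bform (@bform_commutator _ _ _ _ c) => [|i]; last first.
  rewrite -p0inj_lcomb -cE {1}/p0inj uinj_bracket; congr (_ + _).
  rewrite /p0inj /lie0 vsprojK ?p_basis // lie0r linear0.
  by rewrite (_ : lie _ (vsval 0) = 0) ?addr0 // linear0 lie0r.
rewrite invmx_derivation ?gram_unit //.
  rewrite [bform 0 _ _]big1 ?addr0 // => i _.
  by rewrite big1 // => j _; rewrite mxE scale0r.
apply/matrixP => i j; rewrite mxE [RHS]mxE.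
(* Inserting the identity matrix turns both entries into values of beta, so that the condition
   becomes invariance of beta under ad Y. *)
have -> : (c *m B) i j = beta (lcomb c (tnth e) i) (lcomb 1%:M (tnth e) j).
  by rewrite beta_lcomb trmx1 mulmx1.
have -> : (B *m c^T) i j = beta (lcomb 1%:M (tnth e) i) (lcomb c (tnth e) j).
  by rewrite beta_lcomb mul1mx.
rewrite -!cE !lcomb1.
have GY : lie (vsval Y) (tnth e j) \in Lie G by rewrite cE G_lcomb.
(* [k_sub] needs a nonzero vector of p to place Y in [Lie G]. *)
have [->|e0] := eqVneq (tnth e i) 0.
  by rewrite lie0r !(beta0l beta_form) ?addr0 ?G_basis.
apply: (form_lie_inv beta_form); rewrite ?G_basis //.
exact: k_sub (subvsP Y) (p_basis i) e0.
Qed.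

(** Conjugation respects commutators; what remains is that every vector under a projection already
    lies in k or p. *)
Lemma Ad0_bracket h (u v : g0 G theta) : K h ->
  Ad0 h (lie0 u v) = lie0 (Ad0 h u) (Ad0 h v).
Proof.
move=> Kh; have hu := K_unit G_algebraic Kh.
case: u v => [Y1 X1] [Y2 X2]; rewrite /Ad0 /lie0 /=.
have [kY1 kY2] := (subvsP Y1, subvsP Y2); have [pX1 pX2] := (subvsP X1, subvsP X2).
have plie Y X : Y \in k -> X \in p -> lie Y X \in p by exact: (p_lie G_algebraic theta_cartan).
have plie' X Y : X \in p -> Y \in k -> lie X Y \in p.
  by move=> pX kY; rewrite -[lie X Y]opprK memvN [- _]opprB plie.
have kAd X : X \in k -> Ad h X \in k by exact: (k_Ad G_algebraic theta_cartan).
have pAd X : X \in p -> Ad h X \in p by exact: (p_Ad G_algebraic theta_cartan).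
have kl : lie (vsval Y1) (vsval Y2) \in k by exact: (k_lie G_algebraic theta_cartan).
have pl : lie (vsval Y1) (vsval X2) + lie (vsval X1) (vsval Y2) \in p.
  by apply: memvD; [exact: plie | exact: plie'].
congr (vsproj k _, vsproj p _).
  by rewrite (vsprojK kl) (vsprojK (kAd _ kY1)) (vsprojK (kAd _ kY2)) Ad_lie.
rewrite (vsprojK pl) AdD !Ad_lie // (vsprojK (kAd _ kY1)) (vsprojK (kAd _ kY2)).
by rewrite (vsprojK (pAd _ pX1)) (vsprojK (pAd _ pX2)).
Qed.

(** The extension of [Ad0 h] to U(g0) changes variables by the matrix [a] of Ad h on p, which is an
    isometry of the Gram matrix because beta is K-invariant. *)
Lemma Omega_fixed h : K h -> ufixed_by (Ad0 h) (Omega G theta beta e).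
Proof.
move=> Kh; have [||phi phiE] := @uenv_lrmorphism _ _ (@lie0 _ _ G theta) (Ad0 h).
- by move=> a u v; rewrite /Ad0 /= !AdZD !linearP.
- by move=> u v; exact: Ad0_bracket.
exists phi => //.
have pAd i : Ad h (tnth e i) \in p by exact: (p_Ad G_algebraic theta_cartan Kh (p_basis i)).
have [a aE] := lcomb_basis pAd.
have phix i : phi (p0e i) = lcomb a p0e i.
  by rewrite phiE -p0inj_lcomb -aE /Ad0 /= vsprojK ?p_basis // Ad0r linear0.
rewrite Omega_bform.
have -> : phi (bform (invmx B)^T p0e p0e) = bform (invmx B)^T (lcomb a p0e) (lcomb a p0e).
  rewrite linear_sum; apply: eq_bigr => i _; rewrite linear_sum; apply: eq_bigr => j _.
  by rewrite linearZ rmorphM -!phix.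
rewrite bform_lcomb invmx_isometry ?gram_unit //.
apply/matrixP => i j; rewrite -beta_lcomb -!aE mxE.
by apply: (form_K_inv beta_form); rewrite ?G_basis.
Qed.

End Casimir.

Local Close Scope classical_set_scope.

Theorem mainTheorem5 (R : realType) (n : nat) (G : set 'M[Cx R]_n.+1)
    (sigma theta : 'M[Cx R]_n.+1 -> 'M[Cx R]_n.+1)
    (beta : 'M[Cx R]_n.+1 -> 'M[Cx R]_n.+1 -> Cx R)
    (G_algebraic : algebraic_group G)
    (G_connected : zariski_connected G)
    (G_reductive : reductive G)
    (sigma_antiholomorphic : antiholomorphic_involution G sigma)
    (real_points_connected : connected (fixed_points G sigma))
    (real_points_noncompact : ~ compact (fixed_points G sigma))
    (theta_cartan : cartan_involution G sigma theta)
    (beta_form : admissible_form G sigma theta beta)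
    (e : (\dim (pspace G theta)).-tuple 'M[Cx R]_n.+1)
    (e_basis : basis_of (pspace G theta) e) :
  Z_K (Omega G theta beta e).
Proof.
split; first exact: (Omega_central G_algebraic sigma_antiholomorphic
    theta_cartan beta_form e_basis).
by move=> h; exact: (Omega_fixed G_algebraic sigma_antiholomorphic
  theta_cartan beta_form e_basis).
Qed.
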